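(* Let $k$ be an algebraically closed field of characteristic $\neq 2$ and let $p$ be an odd prime. The stably free modules of rank $p$ of Mohan Kumar (over the coordinate ring of the affine variety $Y\cap Z$ over $K=k(T)$ described in the context) split off a trivial line, i.e. each such module $\mathscr{P}$ is of the form $\mathscr{P}\cong\mathscr{P}'\oplus R$ with $R=\mathcal{O}(Y\cap Z)$, and the resulting stably free module $\mathscr{P}'$ of rank $p-1$ has a symplectic structure.
   Context: A symplectic structure on a projective module is a non-degenerate alternating bilinear form. Mohan Kumar's modules: Let $K=k(T)$ and $n=p+1$. Let $f(S)\in K[S]$ be a polynomial of degree $p$ with $f(0)=a\in K^\times$ such that $f(S^{p^{p}})$ is irreducible. Define recursively $$F_1(X_0,X_1)=X_1^p f\left(\tfrac{X_0}{X_1}\right),\qquad F_{i+1}(X_0,\dots,X_{i+1})=F_1\left(F_i(X_0,\dots,X_i),\,a^{\frac{p^i-1}{p-1}}X_{i+1}^{p^i}\right).$$ Let $X=\mathbb{P}^n_K\setminus \operatorname{V}(F_n)$, $Y=(\mathbb{P}^n_K\setminus \operatorname{V}(F_{n-1}))\cap X$ (viewing $F_{n-1}$ as a polynomial in $X_0,\dots,X_n$), and $Z=(\mathbb{P}^n_K\setminus \operatorname{V}(G))\cap X$ with $G=F_{n-1}(X_0,\dots,X_{n-1})-a^{\frac{p^{n-1}-1}{p-1}}X_n^{p^{n-1}}$. Then $X=Y\cup Z$ is a covering by smooth affine open subvarieties. The rational point $y=[0:\cdots:0:1:1]$ lies in $Y$ but not in $Z$, and it is a complete intersection in $Y$: its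 maximal ideal is $\mathfrak{m}_y=\langle b_1,\dots,b_n\rangle$ for a regular sequence $b_1,\dots,b_n\in\mathcal{O}_Y(Y)$. Restricted to $Y\cap Z$, $(b_1,\dots,b_n)$ is a unimodular row of length $n=p+1$, and Mohan Kumar's stably free module $\mathscr{P}$ of rank $p$ is the kernel of the surjection $R^{n}\to R$, $(c_i)\mapsto\sum b_ic_i$, where $R=\mathcal{O}(Y\cap Z)$. *)

(* Defs.v *)
From HB Require Import structures.
From mathcomp Require Import all_boot all_order all_algebra.
From mathcomp Require Import sesquilinear boolp.
From mathcomp Require Import mpoly.

Set Implicit Arguments.
Unset Strict Implicit.
Unset Printing Implicit Defensive.

Import GRing.Theory.
Local Open Scope ring_scope.

Section IdealsAndModules.
Variable R : comNzRingType.

Definition lmod_iso (M N : lmodType R) : Prop :=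
  exists f : {linear M -> N}, bijective f.

Definition stably_free (M : lmodType R) (r : nat) : Prop :=
  exists m : nat, lmod_iso (M * 'rV[R]_m)%type 'rV[R]_(r + m).

(* Non-degeneracy means that x |-> psi x _ is a bijection from M onto its dual,
   not merely that the radical is zero. *)
Definition nondegenerate (M : lmodType R) (psi : {biscalar M}) : Prop :=
  (forall x : M, (forall z : M, psi x z = 0) -> x = 0) /\
  (forall phi : {scalar M}, exists x : M, forall z : M, psi x z = phi z).

Definition alternating (M : lmodType R) (psi : {biscalar M}) : Prop :=
  forall x : M, psi x x = 0.

Definition has_symplectic_structure (M : lmodType R) : Prop :=
  exists psi : {biscalar M}, alternating psi /\ nondegenerate psi.

Definition in_ideal (n : nat) (P : pred 'I_n) (b : 'I_n -> R) (x : R) : Prop :=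
  exists c : 'I_n -> R, x = \sum_(i < n | P i) c i * b i.

Definition regular_sequence (n : nat) (b : 'I_n -> R) : Prop :=
  (forall (i : 'I_n) (x : R),
      in_ideal (fun j : 'I_n => (j < i)%N) b (b i * x) ->
      in_ideal (fun j : 'I_n => (j < i)%N) b x) /\
  ~ in_ideal xpredT b 1.

Definition in_rowker (n : nat) (b : 'I_n -> R) : {pred 'rV[R]_n} :=
  fun c => \sum_(i < n) b i * c 0 i == 0.

Lemma in_rowker_submod n (b : 'I_n -> R) : submod_closed (in_rowker b).
Proof.
split=> [|a u v /eqP hu /eqP hv]; rewrite unfold_in.
  by rewrite big1 // => i _; rewrite mxE mulr0.
rewrite (eq_bigr (fun i => a * (b i * u 0 i) + b i * v 0 i)) => [|i _].
  by rewrite big_split /= -mulr_sumr hu hv mulr0 addr0.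
by rewrite !mxE mulrDr mulrCA.
Qed.

HB.instance Definition _ n (b : 'I_n -> R) :=
  GRing.isSubmodClosed.Build R 'rV[R]_n (in_rowker b) (in_rowker_submod b).

Record rowker (n : nat) (b : 'I_n -> R) : Type :=
  RowKer { rowker_val :> 'rV[R]_n; _ : rowker_val \in in_rowker b }.

HB.instance Definition _ n (b : 'I_n -> R) := [isSub for @rowker_val n b].
HB.instance Definition _ n (b : 'I_n -> R) := [Choice of rowker b by <:].
HB.instance Definition _ n (b : 'I_n -> R) :=
  [SubChoice_isSubLmodule of rowker b by <:].

End IdealsAndModules.

(* O(D_+(s)) for D_+(s) = P^(N-1) \ V(s), s a nonzero form, as the subring of
   Frac K[X_0, ..., X_(N-1)] formed by the fractions g / s^m with g and s^m
   homogeneous of the same degree. Intersections of opens correspond to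
   products: D_+(s) :&: D_+(t) = D_+(s * t). All these rings sit in one field,
   so that the restriction maps between them are inclusions. *)
Section Sections.
Variables (K : fieldType) (N : nat).
Implicit Types s g : {mpoly K[N]}.

Definition has_numerator s (x : {fraction {mpoly K[N]}}) g : Prop :=
  exists m d : nat,
    [/\ s ^+ m != 0, s ^+ m \is d.-homog, g \is d.-homog &
        x = tofrac g / tofrac (s ^+ m)].

Definition is_section s : {pred {fraction {mpoly K[N]}}} :=
  fun x => `[< exists g, has_numerator s x g >].

Lemma is_section_subring s : subring_closed (is_section s).
Proof.
split.
- apply/asboolP; exists 1, 0%N, 0%N.
  by split; rewrite ?expr0 ?oner_eq0 ?dhomog1 // rmorph1 divr1.
- move=> x y /asboolP[g [m [d [s0 hs hg ->]]]].
  move=> /asboolP[g' [m' [d' [s0' hs' hg' ->]]]].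
  apply/asboolP; exists (g * s ^+ m' - g' * s ^+ m), (m + m')%N, (d + d')%N.
  split.
  + by rewrite exprD mulf_neq0.
  + by rewrite exprD dhomogM.
  + apply: rpredB; first exact: dhomogM.
    by rewrite addnC; exact: dhomogM.
  + by rewrite exprD rmorphB !rmorphM /= -mulNr -addf_div ?mulNr ?tofrac_eq0.
- move=> x y /asboolP[g [m [d [s0 hs hg ->]]]].
  move=> /asboolP[g' [m' [d' [s0' hs' hg' ->]]]].
  apply/asboolP; exists (g * g'), (m + m')%N, (d + d')%N.
  split; rewrite ?exprD ?mulf_neq0 ?dhomogM //.
  by rewrite !rmorphM /= invfM mulrACA.
Qed.

HB.instance Definition _ s :=
  GRing.isSubringClosed.Build {fraction {mpoly K[N]}} (is_section s)
    (is_section_subring s).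

Record sections s : Type :=
  Section_ { section_val :> {fraction {mpoly K[N]}};
             _ : section_val \in is_section s }.

HB.instance Definition _ s := [isSub for @section_val s].
HB.instance Definition _ s := [Choice of sections s by <:].
HB.instance Definition _ s := [SubChoice_isSubComNzRing of sections s by <:].

(* The value of g / s^m at a point y of D_+(s) is g(y) / s(y)^m, so it vanishes
   iff g(y) = 0, whatever representation is chosen. *)
Definition vanishes_at s (y : 'I_N -> K) (x : sections s) : Prop :=
  exists2 g, has_numerator s (section_val x) g & g.@[y] = 0.

End Sections.

Section MohanKumar.
Variables (K : fieldType) (p : nat) (f : {poly K}).

Definition mkcoef (i : nat) : K := f.[0] ^+ ((p ^ i - 1) %/ (p - 1)).

(* X_1^p f(X_0 / X_1), evaluated at (u, v), for f of degree p. *)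
Definition mkF1 (N : nat) (u v : {mpoly K[N]}) : {mpoly K[N]} :=
  \sum_(j < p.+1) f`_j *: (u ^+ j * v ^+ (p - j)).

(* F_i as a polynomial in X_0, ..., X_n; only used for i <= n. Starting the
   recursion at F_0 = X_0 yields F_1 = X_1^p f(X_0 / X_1). *)
Fixpoint mkF (n i : nat) : {mpoly K[n.+1]} :=
  if i is j.+1 then mkF1 (mkF n j) (mkcoef j *: 'X_(inord j.+1) ^+ (p ^ j))
  else 'X_(inord 0).

Definition mkG (n : nat) : {mpoly K[n.+1]} :=
  mkF n n.-1 - mkcoef n.-1 *: 'X_(inord n) ^+ (p ^ n.-1).

(* Y = D_+(F_(n-1) F_n) and Y :&: Z = D_+(F_(n-1) F_n G), for n = p + 1. *)
Definition mkOY : comNzRingType := sections (mkF p.+1 p * mkF p.+1 p.+1).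
Definition mkOYZ : comNzRingType :=
  sections (mkF p.+1 p * mkF p.+1 p.+1 * mkG p.+1).

(* The point [0 : ... : 0 : 1 : 1] of P^n, for n = p + 1. *)
Definition mkpoint (i : 'I_p.+2) : K := (p <= i)%:R.

Definition mk_generators (b : 'I_p.+1 -> mkOY) : Prop :=
  regular_sequence b /\
  (forall x : mkOY, vanishes_at mkpoint x <-> in_ideal xpredT b x).

Definition mk_restriction (b : 'I_p.+1 -> mkOY) (c : 'I_p.+1 -> mkOYZ) : Prop :=
  forall i, section_val (c i) = section_val (b i).

End MohanKumar.

(* Main.v *)
(* The row c is unimodular: G vanishes at y, so G^(p+1) / (F_(n-1) F_n) is a
   combination of the b_i over O(Y), and it is a unit over O(Y :&: Z).
   Since n = p + 1 is even, R^n carries a symplectic form psi. Write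
   c = psi(w, _), so that the kernel of c is the orthogonal of w, and choose u
   with psi(w, u) = c(u) = 1. Then w and u span a hyperbolic plane, whose
   orthogonal P' is symplectic with R^n = P' (+) R w (+) R u and
   ker c = P' (+) R w. *)
Require Import Defs.
From HB Require Import structures.
From mathcomp Require Import all_boot all_order all_algebra.
From mathcomp Require Import sesquilinear boolp.
From mathcomp Require Import mpoly.

Set Implicit Arguments.
Unset Strict Implicit.
Unset Printing Implicit Defensive.

Import GRing.Theory.
Local Open Scope ring_scope.

Lemma can_lmod_iso (R : comNzRingType) (M N : lmodType R)
    (f : M -> N) (g : N -> M) :
  linear f -> cancel f g -> cancel g f -> lmod_iso M N.
Proof.
move=> linf fK gK.
pose F : {linear M -> N} := HB.pack f (GRing.isLinear.Build R M N *:%R f linf).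
by exists F; exists g.
Qed.

(** * Orthogonal complement of a hyperbolic pair *)

Section HyperbolicComplement.
Variables (R : comNzRingType) (M : lmodType R) (psi : {biscalar M}) (w d : M).

Definition in_pair_ortho : {pred M} :=
  fun v => (psi w v == 0) && (psi d v == 0).

Lemma in_pair_ortho_submod : submod_closed in_pair_ortho.
Proof.
split=> [|a u v /andP[/eqP wu /eqP du] /andP[/eqP wv /eqP dv]]; rewrite unfold_in.
  by rewrite !linear0r eqxx.
by rewrite !linearPr wu wv du dv mulr0 addr0 eqxx.
Qed.

HB.instance Definition _ :=
  GRing.isSubmodClosed.Build R M in_pair_ortho in_pair_ortho_submod.

Record pair_ortho : Type :=
  PairOrtho { pair_ortho_val :> M; _ : pair_ortho_val \in in_pair_ortho }.

HB.instance Definition _ := [isSub for pair_ortho_val].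
HB.instance Definition _ := [Choice of pair_ortho by <:].
HB.instance Definition _ := [SubChoice_isSubLmodule of pair_ortho by <:].

Lemma pair_orthol (v : pair_ortho) : psi w (val v) = 0.
Proof. by case: v => v /= /andP[/eqP]. Qed.

Lemma pair_orthor (v : pair_ortho) : psi d (val v) = 0.
Proof. by case: v => v /= /andP[_ /eqP]. Qed.

Hypothesis psi_alt : alternating psi.

Lemma alternating_anti u v : psi u v = - psi v u.
Proof.
apply/eqP; rewrite -addr_eq0; have := psi_alt (u + v).
by rewrite linearDl !linearDr !psi_alt add0r addr0 => ->.
Qed.

Hypothesis psi_wd : psi w d = 1.

Let psi_dw : psi d w = -1. Proof. by rewrite alternating_anti psi_wd. Qed.

(** The projection onto the orthogonal of [w] and [d] along their span: since [psi w d = 1] and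
    [psi d w = -1], it kills both. The last sign is [+] for this reason. *)
Let proj_val v : M := v - psi w v *: d + psi d v *: w.

Let proj_subproof v : proj_val v \in in_pair_ortho.
Proof.
rewrite unfold_in /proj_val !linearDr !linearNr !linearZr_LR /=.
by rewrite !psi_alt psi_wd psi_dw !mulr0 !mulr1 mulrN1 oppr0 !addr0 !subrr eqxx.
Qed.

Definition pair_proj v := PairOrtho (proj_subproof v).

Lemma val_pair_proj v : val (pair_proj v) = v - psi w v *: d + psi d v *: w.
Proof. by []. Qed.

Lemma pair_proj_linear : linear pair_proj.
Proof.
move=> a u v; apply: val_inj; rewrite linearP !val_pair_proj !linearPr /=.
rewrite !scalerDl -!scalerA !scalerDr scalerN opprD.
by rewrite !addrA [LHS](ACl (1*3*5*2*4*6)).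
Qed.

Lemma pair_projK (v : pair_ortho) : pair_proj (val v) = v.
Proof.
apply: val_inj.
by rewrite val_pair_proj pair_orthol pair_orthor !scale0r subr0 addr0.
Qed.

(** Projecting changes [u] only by a combination of [w] and [d], to which [v] is orthogonal. *)
Lemma psi_pair_proj (v : pair_ortho) u :
  psi (val v) (val (pair_proj u)) = psi (val v) u.
Proof.
rewrite val_pair_proj linearDr linearBr !linearZr_LR /=.
rewrite (alternating_anti (val v) w) (alternating_anti (val v) d).
by rewrite pair_orthol pair_orthor oppr0 !mulr0 subr0 addr0.
Qed.

Definition pair_ortho_form (u v : pair_ortho) : R := psi (val u) (val v).

Lemma pair_ortho_form_bilinear : bilinear_for
  (GRing.Scale.Law.clone _ _ *%R _) (GRing.Scale.Law.clone _ _ *%R _)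
  pair_ortho_form.
Proof.
by split=> [v|u] a x y; rewrite /pair_ortho_form linearP ?linearPl ?linearPr.
Qed.

HB.instance Definition _ := bilinear_isBilinear.Build R
  pair_ortho pair_ortho R _ _ pair_ortho_form pair_ortho_form_bilinear.

Lemma pair_ortho_symplectic :
  Defs.nondegenerate psi -> has_symplectic_structure pair_ortho.
Proof.
move=> [psi_inj psi_surj]; exists pair_ortho_form; split=> [x|].
  exact: psi_alt.
split=> [x x0|phi].
  apply: val_inj; apply: psi_inj => z.
  by rewrite -psi_pair_proj; exact: x0.
(* Precomposing with the projection extends [phi] to all of [M]. The projection of a vector
   representing this extension then represents [phi]. *)
have linPhi : scalar (phi \o pair_proj).
  by move=> a u v /=; rewrite pair_proj_linear linearP.
pose Phi : {scalar M} := HB.pack (phi \o pair_proj)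
  (GRing.isLinear.Build R M R *%R (phi \o pair_proj) linPhi).
have [x xP] := psi_surj Phi; exists (pair_proj x) => z.
transitivity (psi x (val z)); last by rewrite xP /= pair_projK.
change (psi (val (pair_proj x)) (val z) = psi x (val z)).
by rewrite alternating_anti psi_pair_proj -alternating_anti.
Qed.

Lemma pair_ortho_split : lmod_iso (pair_ortho * 'rV[R]_2)%type M.
Proof.
pose f (x : pair_ortho * 'rV[R]_2) : M := val x.1 + x.2 0 0 *: d + x.2 0 1 *: w.
(* Entry 0 is the coefficient of [d] and entry 1 that of [w]; the latter is [- psi d v] because
   [psi d w = -1]. *)
pose g v : pair_ortho * 'rV[R]_2 :=
  (pair_proj v, \row_i if i == 0 then psi w v else - psi d v).
apply: (@can_lmod_iso _ _ _ f g); rewrite /f /g.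
- move=> a [x r] [y s]; rewrite -[(a *: _ + _).1]/(a *: x + y).
  rewrite -[(a *: _ + _).2]/(a *: r + s) linearP !mxE.
  rewrite !scalerDr !scalerDl -!scalerA /=.
  by rewrite !addrA [LHS](ACl (1*3*5*2*4*6)).
- move=> [x r] /=; set v := (X in pair_proj X).
  have wv : psi w v = r 0 0.
    rewrite !linearDr !linearZr_LR /= pair_orthol psi_wd psi_alt.
    by rewrite add0r mulr1 mulr0 addr0.
  have dv : psi d v = - r 0 1.
    rewrite !linearDr !linearZr_LR /= pair_orthor psi_dw psi_alt.
    by rewrite add0r mulrN1 mulr0 add0r.
  congr (_, _).
    by apply: val_inj; rewrite val_pair_proj wv dv /v scaleNr addrAC addrK addrK.
  apply/rowP=> i; rewrite mxE wv dv opprK.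
  by case: i => [[|[|//]] ilt]; congr (r 0 _); apply: val_inj.
- move=> v /=; rewrite !mxE /= scaleNr.
  by rewrite addrAC addrK subrK.
Qed.

End HyperbolicComplement.

(** * The standard symplectic form on a free module of even rank *)

Section StandardForm.
Variables (R : comNzRingType) (n : nat).

(** Its Gram matrix is antidiagonal with alternating signs. It is thus invertible for every [n], and
    parity matters only for the alternating property. *)
Definition antidiag_form (x y : 'rV[R]_n) : R :=
  \sum_(i < n) (-1) ^+ i * x 0 (rev_ord i) * y 0 i.

Lemma antidiag_form_bilinear : bilinear_for
  (GRing.Scale.Law.clone _ _ *%R _) (GRing.Scale.Law.clone _ _ *%R _)
  antidiag_form.
Proof.
split=> [z|z] a x y; rewrite /antidiag_form /= mulr_sumr -big_split /=;
  apply: eq_bigr => i _; rewrite !mxE.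
- by rewrite mulrDr mulrDl (mulrCA _ a) -!mulrA.
- by rewrite mulrDr (mulrCA _ a).
Qed.

HB.instance Definition _ := bilinear_isBilinear.Build R
  'rV[R]_n 'rV[R]_n R _ _ antidiag_form antidiag_form_bilinear.

(** The vector representing the functional with coefficients [c]; its signs cancel those of the
    form. *)
Definition antidiag_dual (c : 'I_n -> R) : 'rV[R]_n :=
  \row_i ((-1) ^+ (rev_ord i) * c (rev_ord i)).

Lemma antidiag_dualP c x : antidiag_form (antidiag_dual c) x = \sum_i c i * x 0 i.
Proof.
by apply: eq_bigr => i _; rewrite mxE rev_ordK mulrA -expr2 sqrr_sign mul1r.
Qed.

Lemma antidiag_nondegenerate : Defs.nondegenerate antidiag_form.
Proof.
split=> [x x0|phi].
  apply/rowP=> i; rewrite mxE.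
  (* Pairing with the mirrored basis vector isolates the coordinate [i], up to sign. *)
  have : antidiag_form x (delta_mx 0 (rev_ord i)) = 0 by exact: x0.
  rewrite /antidiag_form (bigD1 (rev_ord i)) //= big1 => [|j ji].
    rewrite rev_ordK !mxE !eqxx mulr1 addr0 => /(congr1 ( *%R ((-1) ^+ rev_ord i))).
    by rewrite mulrA -expr2 sqrr_sign mul1r mulr0.
  by rewrite !mxE (negPf ji) andbF mulr0.
exists (antidiag_dual (fun i => phi (delta_mx 0 i))) => z.
transitivity (\sum_i phi (delta_mx 0 i) * z 0 i); first exact: antidiag_dualP.
rewrite [z in RHS]row_sum_delta linear_sum.
by apply: eq_bigr => i _; rewrite linearZ /= mulrC.
Qed.

Hypothesis n_even : ~~ odd n.

Let odd_rev (i : 'I_n) : odd (rev_ord i) = ~~ odd i.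
Proof. by rewrite /= oddB // /= (negPf n_even). Qed.

(* [rev_ord] swaps the parities, so it pairs off terms of opposite signs. *)
Lemma antidiag_alternating : alternating antidiag_form.
Proof.
move=> x; transitivity (antidiag_form x x) => //.
rewrite /antidiag_form (bigID (fun i : 'I_n => odd i)) /= addrC.
rewrite (reindex_inj rev_ord_inj) /=.
rewrite (eq_bigl (fun i : 'I_n => odd i)) => [|i]; last by rewrite odd_rev negbK.
rewrite -big_split big1 //= => i oi.
rewrite rev_ordK -signr_odd -[in X in _ + X]signr_odd odd_rev oi /=.
by rewrite mul1r mulN1r mulNr mulrC subrr.
Qed.

End StandardForm.

(** * Kernels of unimodular rows of even length *)

Lemma unimodular_even_rowker (R : comNzRingType) (n : nat) (c d : 'I_n.+2 -> R) :
  ~~ odd n -> \sum_i c i * d i = 1 ->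
  exists P' : lmodType R,
    [/\ lmod_iso (rowker c) (P' * R^o)%type,
        stably_free P' n &
        has_symplectic_structure P'].
Proof.
move=> n_even cd1.
have n2_even : ~~ odd n.+2 by rewrite /= negbK.
pose psi : {biscalar 'rV[R]_n.+2} := @antidiag_form R n.+2.
have psi_alt : alternating psi by exact: antidiag_alternating.
pose w := antidiag_dual c; pose u : 'rV[R]_n.+2 := \row_i d i.
have psi_w x : psi w x = \sum_i c i * x 0 i by exact: antidiag_dualP.
have psi_wu : psi w u = 1.
  by rewrite psi_w -cd1; apply: eq_bigr => i _; rewrite mxE.
have psi_rowker (x : rowker c) : psi w (val x) = 0.
  by rewrite psi_w; apply/eqP; exact: (valP x).
exists (pair_ortho psi w u); split; last 1 first.
- by apply: pair_ortho_symplectic => //; exact: antidiag_nondegenerate.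
(* The trivial line is spanned by [w]. Since [psi u w = -1], subtracting [z.2 *: w] makes [psi u]
   recover the coordinate [z.2]. *)
- have g_sub (z : pair_ortho psi w u * R^o) :
    val z.1 - z.2 *: w \in in_rowker c.
    rewrite unfold_in -psi_w linearBr linearZr_LR /=.
    by rewrite pair_orthol psi_alt mulr0 subr0.
  pose f (x : rowker c) : pair_ortho psi w u * R^o :=
    (pair_proj psi_alt psi_wu (val x), psi u (val x)).
  pose g z : rowker c := RowKer (g_sub z).
  apply: (@can_lmod_iso _ _ _ f g).
  + by move=> a x y; rewrite /f linearP pair_proj_linear linearPr.
  + move=> x; apply: val_inj.
    by rewrite /f /g /= psi_rowker scale0r subr0 addrK.
  + move=> [y t]; rewrite /f /=.
    have psi_ug : psi u (val y - t *: w) = t.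
      rewrite linearBr linearZr_LR pair_orthor (alternating_anti psi_alt) psi_wu.
      by rewrite /= mulrN1 sub0r opprK.
    congr (_, _) => //; apply: val_inj; rewrite val_pair_proj psi_ug.
    rewrite linearBr linearZr_LR pair_orthol psi_alt /= mulr0 subrr.
    by rewrite scale0r subr0 subrK.
- exists 2; have -> : (n + 2 = n.+2)%N by rewrite addn2.
  exact: pair_ortho_split.
Qed.

(** * Unimodularity after removing a hypersurface through the point *)

Section Restriction.
Variables (K : fieldType) (N : nat) (s t : {mpoly K[N]}).
Hypothesis st_neq0 : s * t != 0.

(** Numerator and denominator are both multiplied by [t ^+ m], which keeps their degrees equal as
    [t] is homogeneous. *)
Lemma is_section_restrict dt (x : sections s) :
  t \is dt.-homog -> section_val x \in is_section (s * t).
Proof.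
move=> t_homog; case: x => x /= /asboolP[g [m [d [sm0 sm_homog g_homog ->]]]].
have t0 : t ^+ m != 0.
  by rewrite expf_neq0 //; apply: contraNneq st_neq0 => ->; rewrite mulr0.
apply/asboolP; exists (g * t ^+ m), m, (d + dt * m)%N; split.
- by rewrite expf_neq0.
- by rewrite exprMn dhomogM // dhomogMn.
- by rewrite dhomogM // dhomogMn.
- by rewrite exprMn !rmorphM /= -mulf_div divff ?mulr1 // tofrac_eq0.
Qed.

(** The degree-zero fraction t^(a+1) / s vanishes at [y], so it is a combination of the [b i]. Where
    [t] is inverted it becomes a unit, and dividing by it gives the coefficients [d i]. *)
Lemma unimodular_restriction dt a n (y : 'I_N -> K)
    (b : 'I_n -> sections s) (c : 'I_n -> sections (s * t)) :
  t \is dt.-homog -> s \is (dt * a.+1).-homog -> t.@[y] = 0 ->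
  (forall x, vanishes_at y x -> in_ideal xpredT b x) ->
  (forall i, section_val (c i) = section_val (b i)) ->
  exists d : 'I_n -> sections (s * t), \sum_i c i * d i = 1.
Proof.
move=> t_homog s_homog ty b_ideal cb.
have [s0 t0] : s != 0 /\ t != 0.
  by apply/andP; rewrite -negb_or -mulf_eq0.
have x_num : has_numerator s (tofrac (t ^+ a.+1) / tofrac (s ^+ 1)) (t ^+ a.+1).
  by exists 1, (dt * a.+1)%N; rewrite expr1 dhomogMn.
have xP : tofrac (t ^+ a.+1) / tofrac (s ^+ 1) \in is_section s.
  by apply/asboolP; exists (t ^+ a.+1).
(* The inverse s / t^(a+1), expanded by s^(a+1) so that the denominator is a power of [s * t]. *)
pose v : {fraction {mpoly K[N]}} :=
  tofrac (s ^+ a.+2) / tofrac ((s * t) ^+ a.+1).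
have vP : v \in is_section (s * t).
  apply/asboolP; exists (s ^+ a.+2), a.+1, (dt * a.+1 * a.+2)%N.
  have degE : (dt * a.+1 * a.+2 = dt * a.+1 * a.+1 + dt * a.+1)%N.
    by rewrite [in LHS]mulnS addnC.
  split=> //; first by rewrite expf_neq0.
  - by rewrite degE exprMn dhomogM // dhomogMn.
  - exact: dhomogMn.
have [e xE] : in_ideal xpredT b (Section_ xP).
  by apply: b_ideal; exists (t ^+ a.+1); rewrite //= rmorphXn /= ty expr0n.
exists (fun i => Section_ (is_section_restrict (e i) t_homog) * Section_ vP).
apply: val_inj; rewrite raddf_sum /=.
transitivity (\sum_i section_val (e i) * section_val (b i) * v).
  by apply: eq_bigr => i _; rewrite /= cb mulrA [X in X * v]mulrC.
rewrite -mulr_suml.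
have -> : \sum_i section_val (e i) * section_val (b i) =
   tofrac (t ^+ a.+1) / tofrac (s ^+ 1).
  by have /(congr1 val) := xE; rewrite raddf_sum /= => ->.
rewrite /v expr1 exprMn [s ^+ a.+2]exprSr !rmorphM.
rewrite mulf_div mulrCA [X in _ / X]mulrCA [X in _ / (_ * X)]mulrC divff //.
by rewrite !mulf_neq0 ?tofrac_eq0 ?expf_neq0.
Qed.

End Restriction.

(** * Degrees and values of Mohan Kumar's forms *)

Section MohanKumarForms.
Variables (K : fieldType) (p : nat) (f : {poly K}).

Lemma mkF1_dhomog N d (u v : {mpoly K[N]}) :
  u \is d.-homog -> v \is d.-homog -> mkF1 p f u v \is (d * p).-homog.
Proof.
move=> u_homog v_homog; apply: rpred_sum => j _; apply: rpredZ.
have -> : (d * p = d * j + d * (p - j))%N by rewrite -mulnDr subnKC // -ltnS.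
by rewrite dhomogM ?dhomogMn.
Qed.

Lemma mkpower_dhomog n i e (a : K) :
  a *: ('X_i : {mpoly K[n]}) ^+ e \is e.-homog.
Proof.
have X_homog : ('X_i : {mpoly K[n]}) \is 1.-homog by rewrite dhomogX /= mdeg1.
by apply: rpredZ; have := dhomogMn e X_homog; rewrite mul1n.
Qed.

Lemma mkF_dhomog n i : mkF p f n i \is (p ^ i).-homog.
Proof.
elim: i => [|i IHi] /=; first by rewrite dhomogX /= mdeg1.
by rewrite expnSr mkF1_dhomog // mkpower_dhomog.
Qed.

Lemma mkG_dhomog n : mkG p f n \is (p ^ n.-1).-homog.
Proof. by rewrite rpredB ?mkF_dhomog ?mkpower_dhomog. Qed.

Hypothesis p_gt1 : (1 < p)%N.

(** The exponent (p^i - 1) / (p - 1) is the geometric sum 1 + p + ... + p^(i-1), so the next one is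
    1 plus [p] times it. *)
Lemma mkcoefS i : mkcoef p f i.+1 = f.[0] * mkcoef p f i ^+ p.
Proof.
rewrite /mkcoef -exprM -exprS; congr (_ ^+ _).
have mkexpE j : ((p ^ j - 1) %/ (p - 1) = \sum_(l < j) p ^ l)%N.
  by rewrite !subn1 predn_exp mulKn // -subn1 subn_gt0.
rewrite !mkexpE big_ord_recl expn0 add1n; congr _.+1.
by rewrite big_distrl; apply: eq_bigr => j _; rewrite /= -expnSr.
Qed.

(** When the coordinates before [i.+1] vanish, so does F_i by induction, and only the term f(0) v^p
    of F_1(F_i, v) survives; [mkcoefS] matches the constants. *)
Lemma meval_mkF n i (y : 'I_n.+1 -> K) :
  (i <= n)%N -> (forall j : 'I_n.+1, (j < i)%N -> y j = 0) ->
  (mkF p f n i).@[y] = mkcoef p f i * y (inord i) ^+ (p ^ i).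
Proof.
elim: i => [|i IHi] le_in y0 /=.
  by rewrite mevalXU /mkcoef subnn div0n expr0 expn0 expr1 mul1r.
have Fi0 : (mkF p f n i).@[y] = 0.
  rewrite IHi ?(ltnW le_in) // => [|j /ltnW]; last exact: y0.
  rewrite y0 ?inordK ?(leqW le_in) // expr0n expn_eq0.
  by rewrite (gtn_eqF (ltnW p_gt1)) mulr0.
rewrite /mkF1 raddf_sum big_ord_recl big1 /= => [|j _]; last first.
  by rewrite mevalZ rmorphM rmorphXn /= Fi0 exprS !mul0r mulr0.
rewrite addr0 mevalZ rmorphM !rmorphXn /= mevalZ rmorphXn /= mevalXU.
rewrite expr0 mul1r subn0 exprMn mkcoefS horner_coef0 expnSr exprM.
by rewrite mulrA.
Qed.

Hypothesis f0_neq0 : f.[0] != 0.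

Lemma mk_restriction_unimodular
    (b : 'I_p.+1 -> mkOY p f) (c : 'I_p.+1 -> mkOYZ p f) :
  mk_generators b -> mk_restriction b c ->
  exists d : 'I_p.+1 -> mkOYZ p f, \sum_i c i * d i = 1.
Proof.
move=> [_ b_ideal] c_restr.
pose y := @mkpoint K p.
have coef_neq0 i : mkcoef p f i != 0 by rewrite expf_neq0.
pose F := mkF p f p.+1; pose G := mkG p f p.+1.
(* The point [0 : ... : 0 : 1] witnesses that F_(p+1) and [G] are nonzero, with values
   [mkcoef p f p.+1] and [- mkcoef p f p]. For F_p, which vanishes there, [y] is used. *)
pose z (j : 'I_p.+2) : K := (j == ord_max)%:R.
have y_max : y (inord p.+1) = 1.
  by rewrite /y /mkpoint inordK // leqnSn.
have Fp_y : (F p).@[y] = mkcoef p f p.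
  rewrite meval_mkF // => [|j jp]; last by rewrite /y /mkpoint leqNgt jp.
  by rewrite /y /mkpoint inordK ?leqnn ?expr1n ?mulr1.
have z_max : z (inord p.+1) = 1.
  by rewrite /z -val_eqE /= inordK // eqxx.
have z_lt (j : 'I_p.+2) : (j < p.+1)%N -> z j = 0.
  by move=> jp; rewrite /z -val_eqE /= ltn_eqF.
have Fp_neq0 : F p != 0.
  by apply: contraNneq (coef_neq0 p) => Fp0; rewrite -Fp_y Fp0 meval0.
have Fp1_neq0 : F p.+1 != 0.
  apply: contraNneq (coef_neq0 p.+1) => Fp0.
  have := meval_mkF (leqnn p.+1) z_lt.
  by rewrite -/(F _) Fp0 meval0 z_max expr1n mulr1 => <-.
have G_neq0 : G != 0.
  apply: contraNneq (coef_neq0 p) => G0.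
  have : G.@[z] = 0 by rewrite G0 meval0.
  rewrite /G /mkG /= mevalB mevalZ rmorphXn /= mevalXU z_max expr1n mulr1.
  rewrite meval_mkF // => [|j /ltnW]; last exact: z_lt.
  rewrite z_lt ?inordK // expr0n expn_eq0 (gtn_eqF (ltnW p_gt1)) mulr0 sub0r.
  by move/eqP; rewrite oppr_eq0.
have G_y : G.@[y] = 0.
  rewrite /G /mkG /= mevalB mevalZ rmorphXn /= mevalXU y_max expr1n mulr1.
  by rewrite Fp_y subrr.
(* The exponent is p + 1 since F_p F_(p+1) has degree p^p + p^(p+1) = p^p (p + 1) and [G] has degree
   p^p. *)
apply: (@unimodular_restriction _ _ _ _ _ (p ^ p) p _ y b) => //.
- by rewrite !mulf_neq0.
- exact: mkG_dhomog.
- by rewrite mulnS -expnSr dhomogM ?mkF_dhomog.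
- by move=> x /b_ideal.
Qed.

End MohanKumarForms.

Theorem corollary6p2 (k : closedFieldType) (p : nat)
    (f : {poly {fraction {poly k}}})
    (b : 'I_p.+1 -> mkOY p f) (c : 'I_p.+1 -> mkOYZ p f) :
  2%N \notin [pchar k] ->
  prime p -> odd p ->
  size f = p.+1 -> f.[0] != 0 -> irreducible_poly (f \Po 'X^(p ^ p)) ->
  mk_generators b -> mk_restriction b c ->
  exists P' : lmodType (mkOYZ p f),
    [/\ lmod_iso (rowker c) (P' * (mkOYZ p f)^o)%type,
        stably_free P' p.-1 &
        has_symplectic_structure P'].
Proof.
move=> _ p_prime p_odd _ f0_neq0 _ b_gen c_restr.
have [d] := mk_restriction_unimodular (prime_gt1 p_prime) f0_neq0 b_gen c_restr.
move: {b b_gen c_restr p_prime f0_neq0} c d.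
(* With p = q + 1 the row has length q + 2 with [q] even, and the complement has rank q = p - 1. *)
case: p f p_odd => [//|q] f q_odd c d; exact: unimodular_even_rowker.
Qed.
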